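(* Let $d\ge 1$ and $k\ge 0$ be integers and put $n=d+k+1$. For every $T\in L_{n,d}$ with $T\neq\hat 0$ (i.e. $T$ is not the empty family), \[ \mu_{n,d}(T)=\prod_{T_i\in T}\mu_{\,n-|T_i|,\;d-|T_i|}(\hat 1)=\prod_{T_i\in T}\mu_{\,k+\operatorname{codim}_d(T_i),\;\operatorname{codim}_d(T_i)-1}(\hat 1). \]
   Context: For integers $n\ge 1$, $d\ge 0$: for a finite set $X$ put $\operatorname{codim}_d(X)=d+1-|X|$. For a family $T=\{T_1,\dots,T_l\}$ of distinct finite sets put $\rho_d(T)=\sum_i\operatorname{codim}_d(T_i)$ (with $\rho_d(\emptyset)=0$) and $D_d(T)=\operatorname{codim}_d(T_1\cap\dots\cap T_l)-\rho_d(T)$. Let $L_{n,d}$ be the set of families $T\subset 2^{\{1,\dots,n\}}$ such that $0\le|T_i|\le d$ for all $T_i\in T$ and $D_d(T')>0$ for every subfamily $T'\subset T$ with $|T'|>1$. Order $L_{n,d}$ by: $T<T'$ iff $\rho_d(T)<\rho_d(T')$ and for every $T_i\in T$ there is $T'_j\in T'$ with $T'_j\subset T_i$. (This poset is isomorphic to the intersection lattice, including the empty intersection, of the arrangement of all affine hyperplanes spanned by $d$-subsets of $n$ generic points in a $d$-dimensional space.) Its minimum $\hat 0$ is the empty family and its maximum $\hat 1$ is $\{\emptyset\}$; for $d=0$ the poset $L_{n,0}$ is $\{\hat0,\hat1\}$. $\mu_{n,d}(T)$ denotes the Möbius function value $\mu(\hat 0,T)$ of $L_{n,d}$, and $\mu_{n,d}(\hat1)=\mu(\hat0,\hat1)$.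 *)

(* Defs.v *)
From HB Require Import structures.
From mathcomp Require Import all_boot all_order all_algebra.

Set Implicit Arguments.
Unset Strict Implicit.
Unset Printing Implicit Defensive.

Import Order.TTheory GRing.Theory Num.Theory.
Local Open Scope ring_scope.

(* [m] bounds the recursion depth; [mobiusE] below is the usual recursion,
   and shows that the bound #|P| used in [mobius] is never reached. *)
Fixpoint mobius_rec (disp : Order.disp_t) (P : finPOrderType disp) (m : nat)
    (x y : P) : int :=
  if m is m'.+1 then
    if x == y then 1
    else if (x < y)%O then - \sum_(z : P | (x <= z < y)%O) mobius_rec m' x z
    else 0
  else 0.

Definition mobius (disp : Order.disp_t) (P : finPOrderType disp) (x y : P) :
  int := mobius_rec #|P| x y.

Lemma mobius_rec_stable (disp : Order.disp_t) (P : finPOrderType disp)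
    (m1 m2 : nat) (x y : P) :
    (#|[pred z : P | (z <= y)%O]| <= m1)%N ->
    (#|[pred z : P | (z <= y)%O]| <= m2)%N ->
  mobius_rec m1 x y = mobius_rec m2 x y.
Proof.
have pos (w : P) : (0 < #|[pred z : P | (z <= w)%O]|)%N.
  by apply/card_gt0P; exists w; rewrite inE.
elim: m1 m2 y => [|m1 IH] [|m2] y; rewrite ?leqn0 ?(gtn_eqF (pos y)) //.
move=> le1 le2 /=; case: ifP => // _; case: ifP => // _.
congr (- _); apply: eq_bigr => z /andP[_ lt_zy].
have lt_card : (#|[pred t : P | (t <= z)%O]| < #|[pred t : P | (t <= y)%O]|)%N.
  apply: proper_card; apply/properP; split.
    by apply/subsetP => t; rewrite !inE => /le_trans; apply; apply: ltW.
  by exists y; rewrite !inE ?lexx // lt_geF.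
by apply: IH; rewrite -ltnS; apply: leq_trans lt_card _.
Qed.

Lemma mobiusE (disp : Order.disp_t) (P : finPOrderType disp) (x y : P) :
  mobius x y =
    if x == y then 1
    else if (x < y)%O then - \sum_(z : P | (x <= z < y)%O) mobius x z
    else 0.
Proof.
rewrite /mobius (mobius_rec_stable (m2 := #|P|.+1)) ?max_card //.
exact: leqW (max_card _).
Qed.

Definition codim (d : nat) (I : finType) (X : {set I}) : int :=
  d.+1%:Z - #|X|%:Z.

Definition rho (d n : nat) (T : {set {set 'I_n}}) : int :=
  \sum_(X in T) codim d X.

(* The empty intersection is the full set; only families with more than one
   member are ever tested below. *)
Definition excess (d n : nat) (T : {set {set 'I_n}}) : int :=
  codim d (\bigcap_(X in T) X) - rho d T.

Definition in_L (d n : nat) (T : {set {set 'I_n}}) : bool :=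
  [forall X in T, (#|X| <= d)%N] &&
  [forall S : {set {set 'I_n}},
     (S \subset T) && (1 < #|S|)%N ==> (0 < excess d S)].

(* The ground set {1, ..., n} is rendered as 'I_n = {0, ..., n - 1}. *)
Record L (n d : nat) : Type := InL {
  fam :> {set {set 'I_n}};
  _ : in_L d fam
}.

HB.instance Definition _ (n d : nat) := [isSub for @fam n d].
HB.instance Definition _ (n d : nat) := [Finite of L n d by <:].

Definition L_lt (n d : nat) (S T : L n d) : bool :=
  (rho d S < rho d T) &&
  [forall X in fam S, exists Y in fam T, Y \subset X].

Lemma L_lt_irr (n d : nat) : irreflexive (@L_lt n d).
Proof. by move=> T; rewrite /L_lt ltxx. Qed.

Lemma L_lt_trans (n d : nat) : transitive (@L_lt n d).
Proof.
move=> T S U /andP[ltST /forall_inP subST] /andP[ltTU /forall_inP subTU].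
rewrite /L_lt (lt_trans ltST ltTU); apply/forall_inP => X XS.
have /exists_inP[Y YT YX] := subST X XS.
have /exists_inP[Z ZU ZY] := subTU Y YT.
by apply/exists_inP; exists Z; rewrite // (subset_trans ZY YX).
Qed.

Fact L_display : Order.disp_t. Proof. exact: Order.Disp tt tt. Qed.

HB.instance Definition _ (n d : nat) :=
  Order.Lt_isPOrder.Build L_display (L n d) (@L_lt_irr n d) (@L_lt_trans n d).

Lemma in_L_bot (n d : nat) : in_L d (set0 : {set {set 'I_n}}).
Proof.
apply/andP; split; first by apply/forall_inP => X; rewrite inE.
apply/forallP => S; apply/implyP => /andP[].
by rewrite subset0 => /eqP->; rewrite cards0.
Qed.

Lemma in_L_top (n d : nat) : in_L d [set (set0 : {set 'I_n})].
Proof.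
apply/andP; split.
  by apply/forall_inP => X; rewrite inE => /eqP->; rewrite cards0.
apply/forallP => S; apply/implyP => /andP[/subset_leq_card].
by rewrite cards1 leqNgt => /negP.
Qed.

Definition L_bot (n d : nat) : L n d := InL (in_L_bot n d).
Definition L_top (n d : nat) : L n d := InL (in_L_top n d).

Lemma codim_gt0 (n d : nat) (T : L n d) (X : {set 'I_n}) :
  X \in fam T -> 0 < codim d X.
Proof.
case: T => T /= /andP[/forall_inP le_d _] /le_d leX.
by rewrite /codim subr_gt0 ltz_nat ltnS.
Qed.

Lemma codim_le (n d : nat) (X : {set 'I_n}) : codim d X <= d.+1%:Z.
Proof. by rewrite /codim lerBlDr lerDl. Qed.

Lemma L_bot_le (n d : nat) (T : L n d) : (L_bot n d <= T)%O.
Proof.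
rewrite le_eqVlt; have [//|neT] := eqVneq (L_bot n d) T.
have /set0Pn[X XT] : fam T != set0.
  by apply: contraNneq neT => T0; apply/eqP/val_inj; rewrite /= T0.
apply/andP; split; last by apply/forall_inP => Y; rewrite inE.
rewrite {1}/rho big_set0 /rho (bigD1 X) //=.
apply: ltr_wpDr; last exact: codim_gt0 XT.
by apply: sumr_ge0 => Y /andP[YT _]; apply: ltW (codim_gt0 YT).
Qed.

Lemma L_le_top (n d : nat) (T : L n d) : (T <= L_top n d)%O.
Proof.
rewrite le_eqVlt; have [//|neT] := eqVneq T (L_top n d).
apply/andP; split; last first.
  apply/forall_inP => X _; apply/exists_inP.
  by exists set0; rewrite ?inE ?sub0set.
have -> : rho d (L_top n d) = d.+1%:Z.
  by rewrite /rho big_set1 /codim cards0 subr0.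
have [lt1|] := ltnP 1 #|fam T|.
  have /andP[_ /forallP/(_ (fam T))] : in_L d (fam T) := valP T.
  rewrite subxx lt1 /= /excess subr_gt0 => /lt_le_trans; apply.
  exact: codim_le.
rewrite leq_eqVlt ltnS leqn0 => /orP[/cards1P[X TX]|]; last first.
  by rewrite cards_eq0 => /eqP->; rewrite /rho big_set0.
rewrite TX /rho big_set1 /codim ltrBlDr ltrDl ltz_nat lt0n cards_eq0.
by apply: contraNneq neT => X0; apply/eqP/val_inj; rewrite /= TX X0.
Qed.

HB.instance Definition _ (n d : nat) :=
  Order.hasBottom.Build L_display (L n d) (@L_bot_le n d).
HB.instance Definition _ (n d : nat) :=
  Order.hasTop.Build L_display (L n d) (@L_le_top n d).

Lemma fam_bot (n d : nat) : fam (\bot%O : L n d) = set0.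
Proof. by []. Qed.

Lemma fam_top (n d : nat) : fam (\top%O : L n d) = [set set0].
Proof. by []. Qed.

Lemma ltL (n d : nat) (S T : L n d) :
  (S < T)%O = (rho d S < rho d T) &&
    [forall X in fam S, exists Y in fam T, Y \subset X].
Proof. by []. Qed.

Definition mu (n d : nat) (T : L n d) : int := mobius \bot%O T.

(* Main.v *)
(** The interval below [T] is the product of the intervals below the singleton
    families [[set X]], [X \in T]: the condition [0 < excess] on pairs of
    members of [T] forces every member of a family below [T] to contain exactly
    one member of [T], and conversely families lying over the various [X] can be
    united freely, because enlarging the members of a family never decreases its
    excess.  Deleting [X] from all sets identifies the interval below [[set X]]
    with the whole lattice in rank [d - #|X|] on [n - #|X|] points. *)

Require Import Defs.
From mathcomp Require Import all_boot all_order all_algebra.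
From mathcomp Require Import zify.

Import Order.TTheory GRing.Theory Num.Theory.
Local Open Scope ring_scope.

Set Implicit Arguments.
Unset Strict Implicit.
Unset Printing Implicit Defensive.

(** * Möbius functions: uniqueness, and transport along embeddings *)

Section Mobius.
Variables (disp : Order.disp_t) (P : finPOrderType disp).
Implicit Types x y z : P.

Lemma mobius_refl x : mobius x x = 1.
Proof. by rewrite mobiusE eqxx. Qed.

Lemma mobius_sum_eq0 x y :
  (x < y)%O -> \sum_(z : P | (x <= z <= y)%O) mobius x z = 0.
Proof.
move=> lt_xy; rewrite (bigD1 y) /=; last by rewrite (ltW lt_xy) lexx.
rewrite mobiusE (lt_eqF lt_xy) lt_xy addrC; apply/eqP.
rewrite subr_eq0; apply/eqP/eq_bigl => z.
by rewrite -andbA [in RHS]lt_neqAle [(z <= y)%O && _]andbC.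
Qed.

(** Vanishing interval sums determine each value from the values strictly below it, whence induction
    on the size of the lower set of [y]. Sums are constrained only up to [y], because the
    application in [mu_prod_restr] controls them only below [T]. *)
Lemma mobius_unique x (f : P -> int) y :
    f x = 1 ->
    (forall z, (x < z)%O -> (z <= y)%O ->
       \sum_(w : P | (x <= w <= z)%O) f w = 0) ->
  (x <= y)%O -> f y = mobius x y.
Proof.
move=> fx sumf; have [m] := ubnP #|[pred z : P | (z <= y)%O]|.
elim: m y sumf => // m IH y sumf ltm le_xy.
have [<-|ne_xy] := eqVneq x y; first by rewrite fx mobius_refl.
have lt_xy : (x < y)%O by rewrite lt_neqAle ne_xy.
have := etrans (sumf y lt_xy (lexx y)) (esym (mobius_sum_eq0 lt_xy)).
have xyy : (x <= y <= y)%O by rewrite le_xy lexx.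
rewrite (bigD1 y) // [in RHS](bigD1 y) //=.
rewrite [X in _ + X = _](_ : _ =
  \sum_(w | (x <= w <= y)%O && (w != y)) mobius x w); first by move/addIr.
apply: eq_bigr => w /andP[/andP[le_xw le_wy] ne_wy].
apply: IH => // [z lt_xz le_zw|]; first exact: sumf (le_trans le_zw le_wy).
rewrite ltnS in ltm; apply: leq_trans ltm; apply: proper_card.
apply/properP; split.
  by apply/subsetP => t; rewrite !inE => /le_trans; apply.
exists y; rewrite !inE ?lexx //.
by apply: contra ne_wy => le_yw; rewrite eq_le le_wy.
Qed.

End Mobius.

(** Since the image is closed downwards, [phi] carries each interval from [x] to [z] onto the whole
    interval from [phi x] to [phi z], so the recursions agree. *)
Lemma mobius_embedding (d1 d2 : Order.disp_t) (P : finPOrderType d1)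
    (Q : finPOrderType d2) (phi : P -> Q) (x y : P) :
    {mono phi : a b / (a <= b)%O} ->
    (forall b c, (c <= phi b)%O -> exists a, phi a = c) ->
  (x <= y)%O -> mobius (phi x) (phi y) = mobius x y.
Proof.
move=> mono_phi down; have lt_mono := leW_mono mono_phi.
move=> le_xy; apply: (mobius_unique (x := x)
  (f := fun z => mobius (phi x) (phi z))) => //.
  exact: mobius_refl.
move=> z lt_xz _; rewrite -lt_mono in lt_xz; apply: etrans (mobius_sum_eq0 lt_xz).
have inj_phi : injective phi by apply: inc_inj.
rewrite -(big_imset (h := phi) (fun w => mobius (phi x) w)
          (A := [pred w | (x <= w <= z)%O])) /=; last first.
  by move=> a b _ _; apply: inj_phi.
apply: eq_bigl => w; apply/imsetP/idP => [[a] + ->|/andP[le_xw le_wz]].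
  by rewrite inE !mono_phi.
have [a def_w] := down _ _ le_wz; exists a => //.
by rewrite inE -!mono_phi def_w le_xw.
Qed.

(** * Families of sets: refinement, [rho] and admissible unions *)

Section Families.
Variables n d : nat.
Implicit Types (X Y Z : {set 'I_n}) (S T : {set {set 'I_n}}).

Lemma in_L_card T X : in_L d T -> X \in T -> (#|X| <= d)%N.
Proof. by move=> /andP[/forall_inP le_d _] /le_d. Qed.

Lemma in_L_sub S T : S \subset T -> in_L d T -> in_L d S.
Proof.
move=> sST /andP[/forall_inP le_d /forallP posT]; apply/andP; split.
  by apply/forall_inP => X /(subsetP sST)/le_d.
apply/forallP => U; apply/implyP => /andP[sUS cardU].
by have /implyP := posT U; apply; rewrite (subset_trans sUS sST).
Qed.

Lemma rho_lt_codim_bigcap T :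
  in_L d T -> (1 < #|T|)%N -> rho d T < codim d (\bigcap_(X in T) X).
Proof.
move=> /andP[_ /forallP/(_ T)]; rewrite subxx /= => /implyP posT /posT.
by rewrite /excess subr_gt0.
Qed.

Lemma codim_subset X Y : X \subset Y -> codim d Y <= codim d X.
Proof. by move/subset_leq_card => le_XY; rewrite /codim; lia. Qed.

Lemma rho_le_codim_bigcap T :
  in_L d T -> T != set0 -> rho d T <= codim d (\bigcap_(X in T) X).
Proof.
move=> TL; rewrite -card_gt0 leq_eqVlt => /orP[/eqP/esym/eqP/cards1P[X ->]|].
  by rewrite /rho !big_set1.
by move/(rho_lt_codim_bigcap TL)/ltW.
Qed.

(* The condition [0 < excess] on [[set X1; X2]] says [d + 1 < #|X1 :|: X2|]. *)
Lemma in_L_subset_unique T X1 X2 Y :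
    in_L d T -> X1 \in T -> X2 \in T -> (#|Y| <= d)%N ->
  X1 \subset Y -> X2 \subset Y -> X1 = X2.
Proof.
move=> TL X1T X2T leY sX1 sX2; apply/eqP/negPn/negP => ne12.
have sT : [set X1; X2] \subset T by apply/subsetP => Z /set2P[] ->.
have := rho_lt_codim_bigcap (in_L_sub sT TL); rewrite cards2 ne12 => /(_ isT).
rewrite /rho !big_setU1 ?inE //= !big_set1 /codim => lt_rho.
have : (#|X1 :|: X2| <= #|Y|)%N by rewrite subset_leq_card // subUset sX1.
by have := cardsUI X1 X2; lia.
Qed.

Definition over X S := [set Y in S | X \subset Y].

Lemma over_sub X S : over X S \subset S.
Proof. by apply/subsetP => Y; rewrite inE => /andP[]. Qed.

Definition refines S T := [forall X in S, exists Y in T, Y \subset X].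

Lemma refinesP S T :
  reflect (forall Y, Y \in S -> exists2 X, X \in T & X \subset Y) (refines S T).
Proof.
apply: (iffP forall_inP) => H Y /H; first by move/exists_inP.
by case=> X XT sXY; apply/exists_inP; exists X.
Qed.

(** By [in_L_subset_unique] each member of [S] contains exactly one member of [T], so the families
    [over X S] partition [S]. *)
Lemma rho_over S T :
    in_L d T -> (forall Y, Y \in S -> (#|Y| <= d)%N) -> refines S T ->
  rho d S = \sum_(X in T) rho d (over X S).
Proof.
move=> TL leS /refinesP refST; rewrite /rho.
under [RHS]eq_bigr => X _.
  rewrite (eq_bigl (fun Y => (Y \in S) && (X \subset Y))); last first.
    by move=> Y; rewrite inE.
  over.
rewrite (exchange_big_dep (mem S)) /=; last by move=> X Y _ /andP[].
apply: eq_bigr => Y YS; have [X XT sXY] := refST Y YS.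
rewrite (big_pred1 X) // => Z /=; rewrite YS /=.
apply/andP/eqP => [[ZT sZY]|-> //].
exact: in_L_subset_unique TL ZT XT (leS _ YS) sZY sXY.
Qed.

(** Two or more members: the excess is positive and the intersection contains [X]. One member: it
    contains [X] properly. No member: [rho] is 0 while [codim d X] is positive. *)
Lemma rho_lt_codim S X :
    in_L d S -> (forall Y, Y \in S -> X \subset Y) -> (#|X| <= d)%N ->
  S != [set X] -> rho d S < codim d X.
Proof.
move=> SL sXS leX neS; have [lt1|] := ltnP 1 #|S|.
  apply: lt_le_trans (rho_lt_codim_bigcap SL lt1) _.
  by apply: codim_subset; apply/bigcapsP.
rewrite leq_eqVlt ltnS leqn0 => /orP[/cards1P[Y defS]|]; last first.
  by rewrite cards_eq0 => /eqP->; rewrite /rho big_set0 /codim; lia.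
have sXY : X \subset Y by apply: sXS; rewrite defS set11.
have /proper_card : X \proper Y.
  by rewrite properEneq sXY andbT; apply: contraNneq neS => ->; rewrite defS.
by rewrite defS /rho big_set1 /codim; lia.
Qed.

(** This makes the rank inequality in the order automatic. Splitting [rho d S] along [rho_over],
    each fibre contributes at most [codim d X], with equality only when it is [[set X]]; if [S]
    differs from [T], some fibre is strict. *)
Lemma refines_rho S T :
  in_L d S -> in_L d T -> refines S T -> S != T -> rho d S < rho d T.
Proof.
move=> SL TL refST neST; have cardS := in_L_card SL; have cardT := in_L_card TL.
rewrite (rho_over TL cardS refST) {2}/rho.
have ltX X : X \in T -> over X S != [set X] -> rho d (over X S) < codim d X.
  move=> XT; apply: rho_lt_codim (cardT _ XT).
    exact: in_L_sub (over_sub _ _) SL.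
  by move=> Y; rewrite inE => /andP[].
have leX X : X \in T -> rho d (over X S) <= codim d X.
  move=> XT; have [->|neX] := eqVneq (over X S) [set X]; last exact/ltW/ltX.
  by rewrite /rho big_set1.
have [X XT neX] : exists2 X, X \in T & over X S != [set X].
  apply/exists_inP; apply: contraR neST; rewrite negb_exists_in.
  move/forall_inP => overE; have {}overE X : X \in T -> over X S = [set X].
    by move=> XT; apply/eqP; rewrite -[_ == _]negbK overE.
  apply/eqP/setP => Y; apply/idP/idP => [YS|YT].
    have [X XT sXY] := refinesP _ _ refST Y YS.
    have : Y \in over X S by rewrite inE YS.
    by rewrite overE // => /set1P->.
  by have := set11 Y; rewrite -{1}(overE _ YT) inE => /andP[].
rewrite (bigD1 X) // [ltRHS](bigD1 X) //=; apply: ltr_leD; first exact: ltX.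
by apply: ler_sum => Y /andP[YT _]; apply: leX.
Qed.

(** Compare a subfamily [S] of the union with the family [I] of those members of [T] that lie under
    it. Enlarging [X] to the intersection [A X] of its fibre lowers the sum of codimensions by the
    number of added points, and the total intersection gains at most that many points, so positivity
    of the excess passes from [I] to [S]. *)
Lemma in_L_bigcup T (f : {set 'I_n} -> {set {set 'I_n}}) :
    in_L d T -> (forall X, X \in T -> in_L d (f X)) ->
    (forall X Y, X \in T -> Y \in f X -> X \subset Y) ->
  in_L d (\bigcup_(X in T) f X).
Proof.
move=> TL fL sXf.
have cardf Y : Y \in \bigcup_(X in T) f X -> (#|Y| <= d)%N.
  by case/bigcupP => X XT; apply: in_L_card (fL X XT).
apply/andP; split; first exact/forall_inP.
apply/forallP => S; apply/implyP => /andP[/subsetP sS cardS].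
have leS Y : Y \in S -> (#|Y| <= d)%N by move/sS/cardf.
have refST : refines S T.
  by apply/refinesP => Y /sS/bigcupP[X XT Yf]; exists X => //; apply: sXf Yf.
have overf X : X \in T -> over X S \subset f X.
  move=> XT; apply/subsetP => Y; rewrite inE => /andP[YS sXY].
  have /bigcupP[Z ZT Yf] := sS Y YS.
  have <- // : Z = X.
  exact: in_L_subset_unique TL ZT XT (leS Y YS) (sXf _ _ ZT Yf) sXY.
have overL X : X \in T -> in_L d (over X S).
  by move=> XT; apply: in_L_sub (overf X XT) (fL X XT).
pose I := [set X in T | over X S != set0].
have rhoS : rho d S = \sum_(X in I) rho d (over X S).
  rewrite (rho_over TL leS refST) (bigID (fun X => over X S == set0)) /=.
  rewrite big1 => [|X /andP[_ /eqP->]]; last by rewrite /rho big_set0.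
  by rewrite add0r; apply: eq_bigl => X; rewrite inE.
have sIT : I \subset T by apply/subsetP => X; rewrite inE => /andP[].
have inI Y : Y \in S -> exists2 X, X \in I & X \subset Y.
  move=> YS; have [X XT sXY] := refinesP _ _ refST Y YS; exists X => //.
  by rewrite inE XT; apply/set0Pn; exists Y; rewrite inE YS.
(* If a single [X] lies under [S], then [S] is a subfamily of [f X], which is admissible by
   hypothesis. *)
rewrite /excess subr_gt0; have [lt1I|leI1] := ltnP 1 #|I|; last first.
  have /set0Pn[Y /inI[X XI _]] : S != set0 by rewrite -card_gt0; lia.
  have defI : I = [set X].
    by apply/esym/eqP; rewrite eqEcard sub1set XI cards1.
  suff defS : over X S = S.
    by rewrite -[S]defS rho_lt_codim_bigcap ?defS // -defS overL ?(subsetP sIT).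
  apply/eqP; rewrite eqEsubset over_sub; apply/subsetP => Z ZS.
  by have [X' + sXZ] := inI Z ZS; rewrite [in X in _ -> X]inE ZS defI => /set1P <-.
pose A X := \bigcap_(Y in over X S) Y.
have rho_leA : rho d S <= \sum_(X in I) codim d (A X).
  rewrite rhoS; apply: ler_sum => X; rewrite inE => /andP[XT ne0].
  exact: rho_le_codim_bigcap (overL X XT) ne0.
have subA X : X \subset A X by apply/bigcapsP => Y; rewrite inE => /andP[].
have codimA X : codim d (A X) = codim d X - #|A X :\: X|%:Z.
  by have := cardsID X (A X); rewrite /codim (setIidPr (subA X)); lia.
have sumA : \sum_(X in I) codim d (A X) =
    rho d I - (\sum_(X in I) #|A X :\: X|)%N%:Z.
  rewrite /rho (big_morph Posz PoszD (erefl _)) -sumrB.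
  by apply: eq_bigr => X _; apply: codimA.
have := rho_lt_codim_bigcap (in_L_sub sIT TL) lt1I.
(* Together with [rho_leA], [sumA] and the positive excess of [I], this bound gives the claim. *)
suff : (#|\bigcap_(Y in S) Y| <=
    #|\bigcap_(X in I) X| + \sum_(X in I) #|A X :\: X|)%N.
  by move: rho_leA; rewrite sumA /codim; lia.
rewrite -(cardsID (\bigcap_(X in I) X) (\bigcap_(Y in S) Y)).
apply: leq_add; first exact: subset_leq_card (subsetIr _ _).
(* A point common to all of [S] but missed by some [X] in [I] lies in [A X], an intersection of
   members of [S]. *)
apply: leq_trans (_ : #|\bigcup_(X in I) (A X :\: X)| <= _)%N.
  apply/subset_leq_card/subsetP => i /setDP[/bigcapP iS niI].
  have [X XI niX] : exists2 X, X \in I & i \notin X.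
    apply/exists_inP; apply: contraR niI; rewrite negb_exists_in => /forall_inP H.
    by apply/bigcapP => X /H; rewrite negbK.
  apply/bigcupP; exists X => //; rewrite inE niX.
  by apply/bigcapP => Y; rewrite inE => /andP[/iS].
elim/big_rec2: _ => [|X m B _ le_m]; first by rewrite cards0.
by apply: leq_trans (leq_card_setU _ _) _; rewrite leq_add2l.
Qed.

End Families.

(** * Lower intervals as products over the members of [T] *)

Section Intervals.
Variables n d : nat.
Implicit Types S T : L n d.

Lemma famL T : in_L d (fam T).
Proof. exact: valP T. Qed.

(** Refinement alone decides the order, since [refines_rho] supplies the rank condition for distinct
    families. *)
Lemma leL S T : (S <= T)%O = refines (fam S) (fam T).
Proof.
rewrite le_eqVlt ltL; apply/idP/idP => [/orP[/eqP->|/andP[] //]|refST].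
  by apply/refinesP => Y YT; exists Y.
have [->|neST] /= := eqVneq S T; first by [].
by rewrite refines_rho ?famL.
Qed.

Definition restr T (X : {set 'I_n}) : L n d :=
  InL (in_L_sub (over_sub X (fam T)) (famL T)).

Lemma mem_restr T X Y : (Y \in fam (restr T X)) = (Y \in fam T) && (X \subset Y).
Proof. by rewrite inE. Qed.

Lemma eqL S T : fam S =i fam T -> S = T.
Proof. by move=> eqST; apply/val_inj/setP. Qed.

(** Restricting to each [X] in [T] is a bijection from the interval below [y] to the product of the
    intervals below the [restr y X]; its inverse takes unions. *)
Lemma sum_restr_prod T y (F : L n d -> int) : (y <= T)%O ->
  \sum_(z : L n d | (z <= y)%O) \prod_(X in fam T) F (restr z X) =
  \prod_(X in fam T) \sum_(w : L n d | (w <= restr y X)%O) F w.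
Proof.
move=> le_yT; have TL := famL T.
have card_le (z : L n d) Z : Z \in fam z -> (#|Z| <= d)%N by apply/in_L_card/famL.
(* The product of sums becomes one sum over functions with value [\bot] off [fam T]; hence the
   default branch in [h]. *)
rewrite (big_distr_big_dep (\bot%O : L n d)) /=.
pose h (z : L n d) := [ffun X => if X \in fam T then restr z X else \bot%O].
(* The default [L_bot n d] never arises for an [f] in the index set: there [in_L_bigcup] shows that
   the union is admissible. *)
pose h' (f : {ffun {set 'I_n} -> L n d}) : L n d :=
  insubd (L_bot n d) (\bigcup_(X in fam T) fam (f X)).
have below w X Y : (w <= restr y X)%O -> Y \in fam w -> X \subset Y.
  rewrite leL => /refinesP refw /refw[Z]; rewrite mem_restr => /andP[_].
  exact: subset_trans.
rewrite [RHS](reindex_onto h h') => [|f /pfamilyP[/supportP f0 fQ]].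
  apply: eq_big => [z|z _]; last by apply: eq_bigr => X XT; rewrite ffunE XT.
  apply/idP/andP => [le_zy|[/pfamilyP[_ hQ] /eqP h'hz]].
    split.
      apply/pfamilyP; split; first by apply/supportP => X /negPf XT; rewrite ffunE XT.
      move=> X XT; rewrite ffunE XT unfold_in leL; apply/refinesP => Z.
      rewrite mem_restr => /andP[Zz sXZ]; move: le_zy; rewrite leL => /refinesP.
      move=> /(_ Z Zz)[Y Yy sYZ]; exists Y => //; rewrite mem_restr Yy.
      move: le_yT; rewrite leL => /refinesP/(_ Y Yy)[X' X'T sX'Y].
      have <- // : X' = X.
      apply: in_L_subset_unique TL X'T XT (card_le _ _ Zz) _ sXZ.
      exact: subset_trans sX'Y sYZ.
    apply/eqP/val_inj; rewrite /h' val_insubd.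
    suff -> : \bigcup_(X in fam T) fam (h z X) = fam z by rewrite famL.
    apply/setP => Z; apply/bigcupP/idP => [[X XT]|Zz].
      by rewrite ffunE XT mem_restr => /andP[].
    have := le_trans le_zy le_yT; rewrite leL => /refinesP/(_ Z Zz)[X XT sXZ].
    by exists X => //; rewrite ffunE XT mem_restr Zz.
  rewrite leL; apply/refinesP => Z Zz.
  have : Z \in fam (h' (h z)) by rewrite h'hz.
  rewrite -[fam _]/(val _) val_insubd; case: ifP => _; last by rewrite inE.
  case/bigcupP => X XT Zh; have := hQ X XT.
  rewrite unfold_in leL => /refinesP/(_ Z Zh)[Y].
  by rewrite mem_restr => /andP[Yy _] sYZ; exists Y.
apply/ffunP => X; rewrite ffunE; case: ifPn => [XT|/f0 //].
have fU : in_L d (\bigcup_(X in fam T) fam (f X)).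
  by apply: in_L_bigcup => // [Z _|Z Y /fQ]; [apply: famL | apply: below].
apply: eqL => Y; rewrite mem_restr -[fam (h' f)]/(val _) val_insubd fU.
apply/andP/idP => [[/bigcupP[Z ZT Yf] sXY]|Yf]; last first.
  by split; [apply/bigcupP; exists X | apply: below (fQ _ XT) Yf].
have <- // : Z = X.
apply: (in_L_subset_unique TL ZT XT (card_le _ _ Yf)) => //.
exact: below (fQ _ ZT) Yf.
Qed.

(** With [T] fixed and [S] varying, the product of the [mu (restr S X)] meets the hypotheses of
    [mobius_unique]: its sum below [y] factors by [sum_restr_prod]. *)
Lemma mu_prod_restr T : mu T = \prod_(X in fam T) mu (restr T X).
Proof.
apply/esym/(mobius_unique (x := \bot%O)
  (f := fun S : L n d => \prod_(X in fam T) mu (restr S X))) => [|y lt0y le_yT|].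
- apply: big1 => X _; rewrite (_ : restr _ X = \bot%O) /mu ?mobius_refl //.
  by apply: eqL => Y; rewrite mem_restr !inE.
- rewrite (eq_bigl (fun z => (z <= y)%O)); last by move=> z; rewrite le0x.
  rewrite sum_restr_prod //; have /set0Pn[Y Yy] : fam y != set0.
    by apply: contraTneq lt0y => y0; rewrite lt0x negbK; apply/eqP/val_inj.
  move: (le_yT); rewrite leL => /refinesP/(_ Y Yy)[X XT sXY].
  (* For this [X], which lies under a member of [y], the family [restr y X] is nonempty, so its
     factor is a vanishing Möbius sum. *)
  rewrite (bigD1 X) //= [X in X * _](_ : _ = 0) ?mul0r //.
  have lt0r : (\bot < restr y X)%O.
    rewrite lt0x; apply: contraTneq (_ : Y \in fam (restr y X)) => [->|].
      by rewrite inE.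
    by rewrite mem_restr Yy.
  apply: etrans (mobius_sum_eq0 lt0r); apply: eq_bigl => w.
  by rewrite le0x.
- exact: le0x.
Qed.

End Intervals.

(** * Deleting [X]: the interval below [[set X]] as a smaller lattice *)

Section Link.
Variables (n d : nat) (X : {set 'I_n}).
Hypothesis leX : (#|X| <= d)%N.

Lemma card_setC_ord : (n - #|X| = #|~: X|)%N.
Proof. by rewrite [RHS]cardsCs setCK card_ord. Qed.

(** Enumerates the complement of [X], so that [join_link] is inverse to deleting [X] from the sets
    containing it. *)
Definition link_emb (i : 'I_(n - #|X|)) : 'I_n :=
  enum_val (cast_ord card_setC_ord i).

Lemma link_emb_inj : injective link_emb.
Proof. by move=> i j /enum_val_inj/cast_ord_inj. Qed.

Lemma link_emb_notin i : link_emb i \notin X.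
Proof. by have := enum_valP (cast_ord card_setC_ord i); rewrite inE. Qed.

Lemma link_emb_surj j : j \notin X -> exists i, j = link_emb i.
Proof.
move=> jX; have jC : j \in ~: X by rewrite inE.
exists (cast_ord (esym card_setC_ord) (enum_rank_in jC j)).
by rewrite /link_emb cast_ordKV enum_rankK_in.
Qed.

Definition join_link (A : {set 'I_(n - #|X|)}) : {set 'I_n} :=
  X :|: link_emb @: A.

Lemma link_emb_join i A : (link_emb i \in join_link A) = (i \in A).
Proof.
by rewrite in_setU (negPf (link_emb_notin i)) mem_imset //; apply: link_emb_inj.
Qed.

Lemma join_linkS A B : (join_link A \subset join_link B) = (A \subset B).
Proof.
apply/idP/idP => [/subsetP sAB|sAB]; last exact/setUS/imsetS.
by apply/subsetP => i; rewrite -!link_emb_join; apply: sAB.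
Qed.

Lemma join_link_inj : injective join_link.
Proof.
by move=> A B eqAB; apply/eqP; rewrite eqEsubset -!join_linkS eqAB subxx.
Qed.

Lemma join_linkK (Y : {set 'I_n}) :
  X \subset Y -> join_link (link_emb @^-1: Y) = Y.
Proof.
move=> /subsetP sXY; apply/setP => j; have [jX|jX] := boolP (j \in X).
  by rewrite in_setU jX sXY.
by have [i ->] := link_emb_surj jX; rewrite link_emb_join inE.
Qed.

Lemma card_join_link A : (#|join_link A| = #|X| + #|A|)%N.
Proof.
rewrite cardsU card_imset; last exact: link_emb_inj.
rewrite (_ : X :&: _ = set0) ?cards0 ?subn0 //; apply/setP => j.
rewrite !inE; apply/andP => -[jX /imsetP[i _ ij]].
by have := link_emb_notin i; rewrite -ij jX.
Qed.

Lemma codim_join_link A : codim d (join_link A) = codim (d - #|X|) A.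
Proof. by rewrite /codim card_join_link; lia. Qed.

Lemma rho_join_link (S : {set {set 'I_(n - #|X|)}}) :
  rho d (join_link @: S) = rho (d - #|X|) S.
Proof.
rewrite /rho big_imset /=; last by move=> A B _ _; apply: join_link_inj.
by apply: eq_bigr => A _; apply: codim_join_link.
Qed.

Lemma bigcap_join_link (S : {set {set 'I_(n - #|X|)}}) : S != set0 ->
  \bigcap_(Y in join_link @: S) Y = join_link (\bigcap_(A in S) A).
Proof.
case/set0Pn => A0 A0S; apply/setP => j; have [jX|jX] := boolP (j \in X).
  rewrite [RHS]in_setU jX; apply/bigcapP => _ /imsetP[A _ ->].
  by rewrite in_setU jX.
have [i ->] := link_emb_surj jX; rewrite link_emb_join.
apply/bigcapP/bigcapP => [iS A AS|iS _ /imsetP[A AS ->]].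
  by rewrite -link_emb_join iS // imset_f.
by rewrite link_emb_join iS.
Qed.

Lemma in_L_join_link (S : {set {set 'I_(n - #|X|)}}) :
  in_L d (join_link @: S) = in_L (d - #|X|) S.
Proof.
have excessE (U : {set {set 'I_(n - #|X|)}}) : (1 < #|U|)%N ->
    excess d (join_link @: U) = excess (d - #|X|) U.
  move=> U1; rewrite /excess rho_join_link bigcap_join_link ?codim_join_link //.
  by rewrite -card_gt0 ltnW.
congr (_ && _).
  apply/forall_inP/forall_inP => le_d => [A AS|_ /imsetP[A AS ->]].
    have := le_d _ (imset_f join_link AS); rewrite card_join_link.
    by lia.
  by have := le_d A AS; rewrite card_join_link; lia.
apply/forallP/forallP => posS U; apply/implyP => /andP[sU U1].
  have /implyP := posS (join_link @: U); rewrite excessE //; apply.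
  by rewrite imsetS //= card_imset //; apply: join_link_inj.
(* Every subfamily of the image is the image of a subfamily of [S], so the same excess conditions
   are tested on both sides. *)
have defU : U = join_link @: [set A in S | join_link A \in U].
  apply/setP => Y; apply/idP/imsetP => [YU|[A + ->]]; last first.
    by rewrite inE => /andP[].
  have /imsetP[A AS defY] := subsetP sU Y YU.
  by exists A; rewrite // inE AS -defY.
move: U1; rewrite {}defU card_imset; last exact: join_link_inj.
move=> V1; rewrite excessE //; have /implyP := posS [set A in S | join_link A \in U].
by apply; rewrite V1 andbT; apply/subsetP => A; rewrite inE => /andP[].
Qed.

Definition link_L (S : L (n - #|X|) (d - #|X|)) : L n d :=
  InL (etrans (in_L_join_link (fam S)) (famL S)).

Lemma link_L_mono : {mono link_L : S T / (S <= T)%O}.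
Proof.
move=> S T; rewrite !leL /=; apply/refinesP/refinesP => ref => [A AS|].
  have [_ /imsetP[B BT ->]] := ref _ (imset_f join_link AS).
  by rewrite join_linkS => sBA; exists B.
move=> _ /imsetP[A /ref[B BT sBA] ->]; exists (join_link B); first exact: imset_f.
by rewrite join_linkS.
Qed.

(** Members of a family below [link_L T] all contain [X], hence lie in the image of [join_link]. *)
Lemma link_L_onto T (S : L n d) : (S <= link_L T)%O -> exists R, link_L R = S.
Proof.
rewrite leL => /refinesP sub.
have defS : join_link @: [set A | join_link A \in fam S] = fam S.
  apply/setP => Y; apply/imsetP/idP => [[A] + ->|YS]; first by rewrite inE.
  have [_ /imsetP[A _ ->] sAY] := sub Y YS.
  have sXY : X \subset Y := subset_trans (subsetUl _ _) sAY.
  by exists (link_emb @^-1: Y); rewrite ?inE join_linkK.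
have RL : in_L (d - #|X|) [set A | join_link A \in fam S].
  by rewrite -in_L_join_link defS famL.
by exists (InL RL); apply/val_inj.
Qed.

(** [link_L] sends the empty family to itself and the top [[set set0]] to [[set X]]. *)
Lemma mu_set1 (S : L n d) : fam S = [set X] ->
  mu S = mu (\top%O : L (n - #|X|) (d - #|X|)).
Proof.
move=> defS; rewrite /mu -(mobius_embedding link_L_mono link_L_onto) ?le0x //.
congr mobius; apply: val_inj; rewrite /=; first by rewrite imset0.
by rewrite imset_set1 /join_link imset0 setU0.
Qed.

End Link.

Theorem theorem13 (d k n : nat) (hd : (1 <= d)%N) (hn : n = (d + k + 1)%N)
    (T : L n d) (hT : T != \bot%O) :
  mu T = \prod_(X in fam T) mu (\top%O : L (n - #|X|) (d - #|X|)) /\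
  \prod_(X in fam T) mu (\top%O : L (n - #|X|) (d - #|X|)) =
    \prod_(X in fam T)
      mu (\top%O : L (k + `|codim d X|%N) (`|codim d X|%N - 1)).
Proof.
have leT X : X \in fam T -> (#|X| <= d)%N by apply/in_L_card/famL.
split.
  rewrite mu_prod_restr; apply: eq_bigr => X XT; apply: mu_set1 (leT X XT) _ _.
  (* No other member of [T] contains [X], so [restr T X] is [[set X]]. *)
  apply/setP => Y; rewrite mem_restr inE; apply/andP/eqP => [[YT sXY]|-> //].
  exact: in_L_subset_unique (famL T) YT XT (leT Y YT) _ sXY.
apply: eq_bigr => X XT; have := leT X XT => leX.
(* As [#|X| <= d], the codimension is positive: the absolute value changes nothing and the
   subtractions are not truncated. *)
have -> : (n - #|X| = k + `|codim d X|)%N by rewrite /codim; lia.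
by have -> : (d - #|X| = `|codim d X| - 1)%N by rewrite /codim; lia.
Qed.
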